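(* Let $X$ be a Hausdorff space. If $A\subseteq X$ is $c$-closed, then $L'(A,X)\leq L'(X)$.
   Context: An open ultrafilter on a Hausdorff space $X$ is a maximal filter in the family of open subsets of $X$ (its members are nonempty open sets); it converges to $x\in X$ if it contains every open set containing $x$. $EX$ is the set of all convergent open ultrafilters on $X$. A section is a function $b:X\to EX$ such that $b(x)$ converges to $x$ for every $x\in X$. For a section $b$ and an open set $U$ let $\widehat{U}_b=\{x\in X: U\in b(x)\}$, and for $A\subseteq X$ let $c_b(A)=\{x\in X:\widehat{U}_b\cap A\neq\varnothing\text{ for every open }U\ni x\}$. $A$ is $c_b$-closed if $c_b(A)=A$. For $A\subseteq X$, $aL(A,X)$ is the least infinite cardinal $\kappa$ such that every cover $\mathcal V$ of $A$ by open sets of $X$ has a subfamily $\mathcal W$ with $|\mathcal W|\leq\kappa$ and $A\subseteq\bigcup_{W\in\mathcal W}cl\,W$. Put $aL^b(X)=\sup\{aL(C,X): C\text{ is }c_b\text{-closed}\}+\aleph_0$ and $aL'(X)=\min\{aL^b(X): b\text{ a section}\}$. Fix any section $b'$ with $aL^{b'}(X)=aL'(X)$ and write $\widehat{U}=\widehat{U}_{b'}$, $c=c_{b'}$; $A$ is $c$-closed if $c(A)=A$. For $A\subseteq X$, $L'(A,X)$ is the least infinite cardinal $\kappa$ such that for every cover $\mathcal V$ of $A$ by open sets of $X$ there is $\mathcal W\subseteq\mathcal V$ with $|\mathcal W|\leq\kappa$ and $A\subseteq\bigcup_{W\in\mathcal W}\widehat{W}$; $L'(X)=L'(X,X)$.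 *)

(* Defs.v *)
From HB Require Import structures.
From mathcomp Require Import all_boot all_order.
From mathcomp Require Import boolp classical_sets functions cardinality topology.

Set Implicit Arguments.
Unset Strict Implicit.
Unset Printing Implicit Defensive.

Local Open Scope classical_set_scope.
Local Open Scope card_scope.

(* A cardinal is represented by a type, considered up to equipotence: the order
   of cardinals is [set: K] #<= [set: L], their equality is [set: K] #= [set: L],
   and the sum of two cardinals is the sum type. *)

Definition is_least_card (P : Type -> Prop) (K : Type) : Prop :=
  P K /\ forall L : Type, P L -> [set: K] #<= [set: L].

(* The value nat is a dummy, taken only when no type satisfies P: see
   least_cardP. *)
Definition least_card (P : Type -> Prop) : Type :=
  if pselect (exists K, is_least_card P K) is left h then sval (cid h) else nat.

Lemma inj_card_leT (T U : Type) (f : T -> U) (A : set T) :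
  injective f -> A #<= [set: U].
Proof.
move=> fI; have e : f @` A #= A by apply: inj_card_eq => x y _ _; exact: fI.
by rewrite -(card_le_eql e); exact: card_leT.
Qed.

(* Apply Zorn's lemma to the subsets of the product of the family on which every
   projection is injective: some projection of a maximal one is onto. *)
Lemma exists_least_family (I : Type) (F : I -> Type) (i0 : I) :
  exists i, forall j, [set: F i] #<= [set: F j].
Proof.
pose T := forall i, F i.
pose good (S : set T) := forall s t i, S s -> S t -> s i = t i -> s = t.
have [G Ggood totG|S [gS maxS]] := @Zorn_bigcup T good.
  move=> s t i [A GA As] [B GB Bt].
  have [AB|BA] := totG _ _ GA GB.
    exact: Ggood GB _ _ _ (AB _ As) Bt.
  exact: Ggood GA _ _ _ As (BA _ Bt).
have [i iS] : exists i, forall k : F i, exists2 s, S s & s i = k.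
  apply: contrapT => /forallNP nS.
  have miss i : exists k : F i, forall s, S s -> s i <> k.
    have /existsNP[k kS] := nS i.
    by exists k => s Ss sk; apply: kS; exists s.
  pose t : T := fun i => sval (cid (miss i)).
  have tS s i : S s -> s i <> t i by rewrite /t; case: cid => k /= + Ss; exact.
  apply: (maxS (S `|` [set t])).
    split=> [|sub]; first by left.
    exact: (tS t i0 (sub t (or_intror erefl))).
  move=> s1 s2 i [S1|->] [S2|->] // e; first exact: gS e.
    by case: (tS _ _ S1 e).
  by case: (tS _ _ S2 (esym e)).
exists i => j; pose g k : T := projT1 (cid2 (iS k)).
have gP k : S (g k) /\ g k i = k by rewrite /g; case: cid2.
apply: (@inj_card_leT _ (F j) (fun k => g k j)) => k l e.
by rewrite -(gP k).2 -(gP l).2 (gS _ _ _ (gP k).1 (gP l).1 e).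
Qed.

Lemma card_leT_total (K L : Type) :
  [set: K] #<= [set: L] \/ [set: L] #<= [set: K].
Proof.
have [[] le] := exists_least_family (fun b : bool => if b then K else L) true.
  by left; exact: (le false).
by right; exact: (le true).
Qed.

Lemma exists_least_card (P : Type -> Prop) :
  (exists K, P K) -> exists K, is_least_card P K.
Proof.
move=> [K0 PK0].
pose Q (S : set K0) := exists2 K, P K & [set: K] #= S.
have QT : Q setT by exists K0.
have [[S [K PK eKS]] /= Smin] :=
  exists_least_family (fun i : {S : set K0 | Q S} => set_type (sval i))
    (exist _ _ QT).
have valE (A : set K0) : [set: A] #= A by exact: card_setT.
exists K; split=> // L PL.
have leS (A : set K0) : Q A -> [set: K] #<= A.
  move=> QA; rewrite (card_le_eql eKS) -(card_le_eql (valE S)).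
  by rewrite -(card_le_eqr (valE A)); exact: (Smin (exist _ A QA)).
have [le|/card_subP[A eAL _]] := card_leT_total K0 L.
  exact: card_le_trans (leS _ QT) le.
have QA : Q A by exists L => //; exact: card_esym.
by rewrite -(card_le_eqr eAL); exact: leS.
Qed.

Lemma least_cardP (P : Type -> Prop) :
  (exists K, P K) -> is_least_card P (least_card P).
Proof.
rewrite /least_card => /exists_least_card h.
by case: pselect => // h'; case: cid.
Qed.

Section CoveringCardinals.
Variable X : topologicalType.
Implicit Types (A U : set X) (p : set (set X)).

Definition open_filter p : Prop :=
  [/\ p !=set0,
      forall U, p U -> open U /\ U !=set0,
      forall U V, p U -> p V -> p (U `&` V) &
      forall U V, p U -> open V -> U `<=` V -> p V].

Definition open_ultrafilter p : Prop :=
  open_filter p /\ forall q, open_filter q -> p `<=` q -> q = p.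

Definition converges p (x : X) : Prop := forall U, open U -> U x -> p U.

Definition EX : Type :=
  {p : set (set X) | open_ultrafilter p /\ exists x, converges p x}.

Definition is_section (b : X -> EX) : Prop := forall x, converges (sval (b x)) x.

Definition hat (b : X -> EX) (U : set X) : set X := [set x | sval (b x) U].

Definition c_ (b : X -> EX) (A : set X) : set X :=
  [set x | forall U, open U -> U x -> hat b U `&` A !=set0].

Definition c_closed (b : X -> EX) (A : set X) : Prop := c_ b A = A.

(* Shared by aL (h = closure) and L' (h = hat b). *)
Definition cover_bound (h : set X -> set X) (A : set X) (K : Type) : Prop :=
  infinite_set [set: K] /\
  forall V : set (set X),
    (forall U, V U -> open U) -> A `<=` \bigcup_(U in V) U ->
    exists W : set (set X),
      [/\ W `<=` V, W #<= [set: K] & A `<=` \bigcup_(U in W) h U].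

Definition aL A : Type := least_card (cover_bound closure A).

Definition L' (b : X -> EX) A : Type := least_card (cover_bound (hat b) A).

(* The supremum is a least upper bound; the summand nat is aleph_0. *)
Definition aLb (b : X -> EX) : Type :=
  (least_card (fun K => forall C, c_closed b C -> [set: aL C] #<= [set: K])
   + nat)%type.

Definition aL' : Type :=
  least_card (fun K => exists2 b, is_section b & [set: K] #= [set: aLb b]).

Lemma exists_cover_bound (h : set X -> set X) A :
  (forall U, open U -> U `<=` h U) -> exists K, cover_bound h A K.
Proof.
move=> hU; exists (set X + nat)%type; split.
  apply/infiniteP; apply: (@inj_card_leT _ (set X + nat)%type inr).
  by move=> m n [].
move=> V Vo AV; exists V; split=> //.
  by apply: (@inj_card_leT _ (set X + nat)%type inl) => U W [].
by move=> x /AV[U VU Ux]; exists U => //; exact: hU (Vo _ VU) _ Ux.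
Qed.

Lemma aLP A : is_least_card (cover_bound closure A) (aL A).
Proof.
by apply: least_cardP; apply: exists_cover_bound => U _; exact: subset_closure.
Qed.

Lemma L'P (b : X -> EX) A :
  is_section b -> is_least_card (cover_bound (hat b) A) (L' b A).
Proof.
move=> bs; apply: least_cardP; apply: exists_cover_bound => U Uo x Ux.
exact: bs.
Qed.

Lemma exists_aL_ub (b : X -> EX) :
  exists K : Type, forall C, c_closed b C -> [set: aL C] #<= [set: K].
Proof.
exists {C : set X & aL C} => C _.
apply: (@inj_card_leT _ {C : set X & aL C} (existT _ C)) => x y.
exact: eq_from_Tagged.
Qed.

End CoveringCardinals.

(* Main.v *)
Require Import Defs.
From HB Require Import structures.
From mathcomp Require Import all_boot all_order.
From mathcomp Require Import boolp classical_sets functions cardinality topology.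

Local Open Scope classical_set_scope.
Local Open Scope card_scope.

(** Each point outside a [c]-closed set [A] has an open neighbourhood whose hat
    misses [A].  Adding all such open sets to a cover of [A] gives a cover of the
    space, and in a subfamily whose hats cover the space only the members of the
    original cover contribute to [A]. *)

Lemma cover_bound_c_closed (X : topologicalType) (b : X -> EX X) (A : set X)
    (K : Type) :
  c_closed b A -> cover_bound (hat b) [set: X] K -> cover_bound (hat b) A K.
Proof.
move=> cA [infK coverK]; split=> // V Vo AV.
pose V' := V `|` [set U | open U /\ hat b U `&` A = set0].
have [U [/Vo|[]]//|x _|W [WV' WK XW]] := coverK V'.
  have [/AV[U VU Ux]|nAx] := pselect (A x); first by exists U => //; left.
  (* Negating the definition of [c_] at [x] yields an open [U] around [x] whose hat misses [A]. *)
  have : ~ c_ b A x by rewrite cA.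
  move=> /existsNP[U /not_implyP[Uo /not_implyP[Ux /set0P/negP]]].
  by rewrite negbK => /eqP UA0; exists U => //; right.
exists (W `&` V); split; first exact: subIsetr.
  exact: card_le_trans (subset_card_le (@subIsetl _ W V)) WK.
move=> x Ax; have [U WU Ux] := XW x I; exists U => //; split=> //.
(* If [U] came from the added sets, [x] would lie in the empty set [hat b U]&[A]. *)
by have [//|[_ UA0]] := WV' U WU; have : set0 x by rewrite -UA0.
Qed.

Theorem proposition3p2 (X : topologicalType) (hX : hausdorff_space X)
    (b' : X -> EX X) (hb' : is_section b')
    (hmin : [set: aLb b'] #= [set: aL' X])
    (A : set X) (hA : c_closed b' A) :
  [set: L' b' A] #<= [set: L' b' [set: X]].
Proof.
(* For a section both least cardinals are attained: [L' b' [set: X]] bounds covers of the space,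
   hence covers of [A], and [L' b' A] is least among the bounds for [A]. *)
have [_ leastA] := L'P A hb'; have [boundX _] := L'P [set: X] hb'.
exact/leastA/cover_bound_c_closed.
Qed.
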